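(* Let $G$ and $H$ be topological groups satisfying one of the following two conditions: (i) $G$ is pathwise connected and $H$ is hereditarily disconnected; (ii) $G$ is a precompact group and $H$ is a topological group without nontrivial precompact subgroups. If two spaces $X$ and $Y$ are $(G\times H)$-equivalent, then they are both $G$-equivalent and $H$-equivalent.
   Context: All spaces are Tychonoff and non-empty; all topological groups are Hausdorff. For a topological group $K$, $C_p(X,K)$ is the group of all continuous maps $X\to K$ with pointwise group operations and the topology of pointwise convergence. Spaces $X,Y$ are $K$-equivalent if $C_p(X,K)$ and $C_p(Y,K)$ are topologically isomorphic. A group is precompact if it is a subgroup of some compact group. *)

(* Defs.v *)
From HB Require Import structures.
From mathcomp Require Import all_boot all_order all_algebra.
From mathcomp Require Import all_classical all_reals all_analysis.
From mathcomp Require Import Rstruct Rstruct_topology.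
Set Implicit Arguments. Unset Strict Implicit. Unset Printing Implicit Defensive.
Import Order.TTheory GRing.Theory Num.Theory.
Local Open Scope classical_set_scope.
Local Open Scope ring_scope.

Definition tychonoff_space (X : topologicalType) : Prop :=
  [/\ inhabited X, accessible_space X &
      forall (a : X) (B : set X), closed B -> ~ B a ->
        exists f : X -> Rdefinitions.R,
          [/\ continuous f, f a = 0 & forall b, B b -> f b = 1]].

Record topGroup := TopGroup {
  tg_carrier :> topologicalType;
  tg_mul : tg_carrier -> tg_carrier -> tg_carrier;
  tg_one : tg_carrier;
  tg_inv : tg_carrier -> tg_carrier;
  tg_mulA : associative tg_mul;
  tg_mul1g : left_id tg_one tg_mul;
  tg_mulVg : left_inverse tg_one tg_inv tg_mul;
  tg_mul_cont : continuous (fun p : tg_carrier * tg_carrier => tg_mul p.1 p.2);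
  tg_inv_cont : continuous tg_inv;
  tg_hausdorff : hausdorff_space tg_carrier }.

(** C_p(X,K): continuous maps X -> K with the topology of pointwise
    convergence, i.e. the subspace of the product {ptws X -> K}
    (set_type carries the initial = subspace topology). *)
Definition Cpset (X K : topologicalType) : set {ptws X -> K} :=
  [set f | continuous (f : X -> K)].
Arguments Cpset : clear implicits.
Notation Cp X K := (set_type (Cpset X K)).

Definition Cp_equiv (K : topologicalType) (mulK : K -> K -> K)
    (X Y : topologicalType) : Prop :=
  exists (Phi : Cp X K -> Cp Y K) (Psi : Cp Y K -> Cp X K),
    [/\ cancel Phi Psi, cancel Psi Phi,
        continuous Phi, continuous Psi &
        forall f g h : Cp X K,
          (forall x, set_val h x = mulK (set_val f x) (set_val g x)) ->
          forall y, set_val (Phi h) y =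
                    mulK (set_val (Phi f) y) (set_val (Phi g) y)].

Definition K_equivalent (K : topGroup) (X Y : topologicalType) : Prop :=
  Cp_equiv (@tg_mul K) X Y.

Definition prod_mul (G H : topGroup) (a b : (G * H)%type) : (G * H)%type :=
  (tg_mul a.1 b.1, tg_mul a.2 b.2).
Definition GxH_equivalent (G H : topGroup) (X Y : topologicalType) : Prop :=
  @Cp_equiv (G * H)%type (@prod_mul G H) X Y.

Definition pathwise_connected (T : topologicalType) : Prop :=
  forall x y : T, exists p : Rdefinitions.R -> T,
    [/\ {within `[0%R, 1%R], continuous p}, p 0 = x & p 1 = y].

Definition hereditarily_disconnected (T : topologicalType) : Prop :=
  forall A : set T, connected A -> forall x y, A x -> A y -> x = y.

Definition is_subgroup (G : topGroup) (S : set G) : Prop :=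
  [/\ S (tg_one G),
      forall x y, S x -> S y -> S (tg_mul x y) &
      forall x, S x -> S (tg_inv x)].

(** A subgroup S of G is precompact if it is (topologically isomorphic to)
    a subgroup of a compact (Hausdorff) group K: there is a map phi that is
    an injective homomorphism on S and a homeomorphism from S (subspace
    topology) onto its image phi(S) (subspace topology). *)
Definition precompact_subgroup (G : topGroup) (S : set G) : Prop :=
  exists (K : topGroup) (phi : G -> K),
    [/\ compact [set: K],
        forall x y, S x -> S y -> phi (tg_mul x y) = tg_mul (phi x) (phi y),
        forall x y, S x -> S y -> phi x = phi y -> x = y,
        {within S, continuous phi} &
        forall U : set G, open U ->
          exists W : set K, open W /\ phi @` (U `&` S) = W `&` (phi @` S)].

Definition precompact_group (G : topGroup) : Prop :=
  precompact_subgroup [set: G].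

Definition no_nontrivial_precompact_subgroups (H : topGroup) : Prop :=
  forall S : set H, is_subgroup S -> precompact_subgroup S -> S = [set tg_one H].

(* Main.v *)
Require Import Defs.
From mathcomp Require Import all_boot all_order all_algebra.
From mathcomp Require Import all_classical all_reals all_analysis.
From mathcomp Require Import Rstruct Rstruct_topology.
Set Implicit Arguments. Unset Strict Implicit. Unset Printing Implicit Defensive.
Import Order.TTheory GRing.Theory Num.Theory.
Local Open Scope classical_set_scope.
Local Open Scope ring_scope.

(** The isomorphism [Phi] of [C_p(X, G * H)] onto [C_p(Y, G * H)] restricts to
    [C_p(X, G) -> C_p(Y, G)] as soon as each map [f |-> (Phi (f, 1) y).2] is
    trivial, so it suffices that a continuous homomorphism [theta] from
    [C_p(X, G)] to [H] is trivial; the factor [H] is then handled by passing to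
    the quotient by the factor [G].

    (i) If [q] is a path in [G] with [q 0 = 1] and [u] is a real function on [X],
    then [t |-> theta (q o (t u))] is a path in [H], hence constant, so
    [theta (q o u) = 1].  Products of such maps interpolate any continuous map
    on any finite set, so the kernel of [theta] is dense; it is also closed.

    (ii) [C_p(X, G)] embeds in a compact group, and the image of a subgroup [P]
    of a compact group under a continuous homomorphism [theta] is precompact:
    replacing the compact group by the closure [M] of [P], let [N] be the
    intersection of the closures in [M] of the sets [theta^-1 U], [U] ranging
    over the neighbourhoods of [1].  Then [N] is a closed normal subgroup and
    [theta p |-> p N] embeds the image in the compact group [M / N]. *)

Local Notation "x ** y" := (tg_mul x y) (at level 40, left associativity).
Local Notation inv := (@tg_inv _).
Local Notation e := (@tg_one _).
Local Notation Rr := Rdefinitions.R.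

(** * Topological groups *)

Section TopGroupTheory.
Variable G : topGroup.
Implicit Types (x y z : G) (A B U V : set G).

Lemma tg_mulgV x : x ** inv x = e.
Proof.
rewrite -[LHS]tg_mul1g -{1}(tg_mulVg (inv x)) -tg_mulA.
by rewrite (tg_mulA (inv x) x) tg_mulVg tg_mul1g tg_mulVg.
Qed.

Lemma tg_mulg1 x : x ** e = x.
Proof. by rewrite -(tg_mulVg x) tg_mulA tg_mulgV tg_mul1g. Qed.

Lemma tg_mulKg x y : inv x ** (x ** y) = y.
Proof. by rewrite tg_mulA tg_mulVg tg_mul1g. Qed.

Lemma tg_mulKVg x y : x ** (inv x ** y) = y.
Proof. by rewrite tg_mulA tg_mulgV tg_mul1g. Qed.

Lemma tg_mulgK x y : y ** x ** inv x = y.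
Proof. by rewrite -tg_mulA tg_mulgV tg_mulg1. Qed.

Lemma tg_mulgKV x y : y ** inv x ** x = y.
Proof. by rewrite -tg_mulA tg_mulVg tg_mulg1. Qed.

Lemma tg_invgK x : inv (inv x) = x.
Proof. by rewrite -[LHS]tg_mulg1 -(tg_mulVg x) tg_mulKg. Qed.

Lemma tg_inv1 : inv e = e :> G.
Proof. by rewrite -[LHS]tg_mulg1 tg_mulVg. Qed.

Lemma tg_invMg x y : inv (x ** y) = inv y ** inv x.
Proof.
by rewrite -[RHS](tg_mulKg (x ** y)) (tg_mulA (x ** y)) tg_mulgK tg_mulgV tg_mulg1.
Qed.

Lemma tg_idem x : x = x ** x -> x = e.
Proof. by move=> xx; rewrite -(tg_mulVg x) {3}xx tg_mulKg. Qed.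

Lemma tg_eqVM x y : inv x ** y = e -> x = y.
Proof. by move=> xy; rewrite -[RHS](tg_mulKVg x) xy tg_mulg1. Qed.

Lemma tg_cvgM T (F : set_system T) {FF : Filter F} (f g : T -> G) x y :
  f @ F --> x -> g @ F --> y -> (fun t => f t ** g t) @ F --> x ** y.
Proof.
apply: continuous2_cvg.
exact: (@tg_mul_cont G (x, y)).
Qed.

Lemma tg_cvgV T (F : set_system T) {FF : Filter F} (f : T -> G) x :
  f @ F --> x -> (fun t => inv (f t)) @ F --> inv x.
Proof. by move=> fx; apply: continuous_cvg => //; exact: tg_inv_cont. Qed.

Lemma tg_mull_cont x : continuous (fun y => x ** y).
Proof. by move=> y; apply: tg_cvgM; [exact: cvg_cst|exact: cvg_id]. Qed.

Lemma tg_mulr_cont x : continuous (fun y => y ** x).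
Proof. by move=> y; apply: tg_cvgM; [exact: cvg_id|exact: cvg_cst]. Qed.

Lemma nbhs_mull x y A : nbhs (x ** y) A -> nbhs y [set z | A (x ** z)].
Proof. exact: tg_mull_cont. Qed.

Lemma nbhs_mull1 x A : nbhs x A -> nbhs e [set z | A (x ** z)].
Proof. by move=> xA; apply: nbhs_mull; rewrite tg_mulg1. Qed.

Lemma nbhs_mulVl x A : nbhs e A -> nbhs x [set z | A (inv x ** z)].
Proof. by move=> eA; apply: nbhs_mull; rewrite tg_mulVg. Qed.

Lemma nbhs1_mul U : nbhs e U ->
  exists2 V, nbhs e V & forall x y, V x -> V y -> U (x ** y).
Proof.
rewrite -{1}[e]tg_mul1g => /(@tg_mul_cont G (e, e))[[A B] /= [eA eB] AB].
by exists (A `&` B); [exact: filterI|move=> x y [Ax _] [_ By]; exact: (AB (x, y))].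
Qed.

Lemma nbhs1_inv U : nbhs e U -> nbhs e [set x | U (inv x)].
Proof. by rewrite -{1}tg_inv1 => /tg_inv_cont. Qed.

Lemma closure_mul A B C x y : (forall a b, A a -> B b -> C (a ** b)) ->
  closure A x -> closure B y -> closure C (x ** y).
Proof.
move=> AB Ax By W /(@tg_mul_cont G (x, y))[[P Q] /= [xP yQ] PQ].
have [a [Aa Pa]] := Ax _ xP; have [b [Bb Qb]] := By _ yQ.
by exists (a ** b); split; [exact: AB|exact: (PQ (a, b))].
Qed.

Lemma tg_eq1 x : (forall U, nbhs e U -> U x) -> x = e.
Proof.
move=> xU; apply/esym/tg_hausdorff => A B eA xB.
exists x; split; [exact: xU|exact: nbhs_singleton].
Qed.

End TopGroupTheory.

(** * Closures, convergence and continuity in subspaces and products *)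

Lemma closure_image (T U : topologicalType) (f : T -> U) (A : set T) (B : set U)
    (x : T) : {for x, continuous f} -> (forall a, A a -> B (f a)) ->
  closure A x -> closure B (f x).
Proof. by move=> cf AB Ax W /cf /Ax[a [Aa Wa]]; exists (f a); split; [exact: AB|]. Qed.

Lemma prod_topology_cvg (I : Type) (T : I -> topologicalType)
    (F : set_system (prod_topology T)) {FF : Filter F} (f : prod_topology T) :
  F --> f <-> forall i, (fun g : prod_topology T => g i) @ F --> f i.
Proof.
split.
  move=> Ff i; apply: cvg_trans; last exact: (@proj_continuous {classic I} T i).
  exact: cvg_app.
move=> Ff; apply/cvg_sup => i W [V [[Z oZ <-] /= Zf VW]].
by apply: filterS VW _; apply: (Ff i); exact: open_nbhs_nbhs.
Qed.

Lemma set_type_cvg (T : topologicalType) (A : set T) (S : Type)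
    (F : set_system S) {FF : Filter F} (f : S -> set_type A) (x : set_type A) :
  f @ F --> x <-> (fun s => set_val (f s)) @ F --> set_val x.
Proof.
split=> [fx|fx W [V [[Z oZ <-] /= Zx VW]]].
  exact: continuous_cvg (@initial_continuous _ _ _ _) fx.
by apply: filterS (fun s => VW (f s)) _; apply: fx; exact: open_nbhs_nbhs.
Qed.

Lemma set_type_hausdorff (T : topologicalType) (A : set T) :
  hausdorff_space T -> hausdorff_space (set_type A).
Proof.
move=> hT p q pq; apply/val_inj/hT => B C pB qC.
have [r [Br Cr]] := pq _ _ ((@initial_continuous _ _ set_val p) _ pB)
  ((@initial_continuous _ _ set_val q) _ qC).
by exists (set_val r).
Qed.

Lemma set_type_continuous (S T : topologicalType) (A : set T) (f : S -> set_type A) :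
  continuous (fun s => set_val (f s)) -> continuous f.
Proof. by move=> cf s; apply/(set_type_cvg (F := nbhs s)); exact: cf. Qed.

Lemma set_val_continuous (T : topologicalType) (A : set T) :
  continuous (@set_val T A).
Proof. exact: initial_continuous. Qed.

Lemma prod_topology_continuous (S : topologicalType) (I : Type)
    (T : I -> topologicalType) (f : S -> prod_topology T) :
  (forall i, continuous (fun s => f s i)) -> continuous f.
Proof.
by move=> cf s; apply/(prod_topology_cvg (F := f @ nbhs s)) => i; exact: cf.
Qed.

Lemma continuous_mul (G : topGroup) (T : topologicalType) (f g : T -> G) :
  continuous f -> continuous g -> continuous (fun t => f t ** g t).
Proof. by move=> cf cg t; apply: (tg_cvgM (F := nbhs t)); [exact: cf|exact: cg]. Qed.

Lemma continuous_inv (G : topGroup) (T : topologicalType) (f : T -> G) :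
  continuous f -> continuous (fun t => inv (f t)).
Proof. by move=> cf t; apply: (tg_cvgV (F := nbhs t)); exact: cf. Qed.

Lemma fst_continuous (S T : topologicalType) : continuous (@fst S T).
Proof. by move=> [x y]; exact: (@cvg_fst _ _ (nbhs x) (nbhs y)). Qed.

Lemma snd_continuous (S T : topologicalType) : continuous (@snd S T).
Proof. by move=> [x y]; exact: (@cvg_snd _ _ (nbhs x) (nbhs y)). Qed.

Lemma comp_continuous (R S T : topologicalType) (f : R -> S) (g : S -> T) :
  continuous f -> continuous g -> continuous (fun x => g (f x)).
Proof. by move=> cf cg x; apply: (@continuous_comp _ _ _ f g); [exact: cf|exact: cg]. Qed.

(** * Subgroups, powers and quotients *)

Lemma compact_set_type (T : topologicalType) (A : set T) :
  compact A -> compact [set: set_type A].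
Proof.
move=> cA F FF FT.
have FS : F [set x | A (set_val x)] by apply: filterS FT => x _; exact: set_valP.
have [x [Ax xF]] := cA (@set_val _ A @ F) _ FS; exists (SigSub (mem_set Ax)); split=> // B C FB.
move=> [V [[Z oZ <-] Zx VC]].
have [z [[b Bb <-] Zz]] : set_val @` B `&` Z !=set0.
  apply: xF; last exact: open_nbhs_nbhs.
  by apply: (@filterS _ F _ B) => // b Bb; exists b.
by exists b; split=> //; exact: VC.
Qed.

Section SubTopGroup.
Variables (G : topGroup) (S : set G) (sS : is_subgroup S).

Definition sub_elt (x : G) (Sx : S x) : set_type S := SigSub (mem_set Sx).

Lemma sub_mul_subproof (x y : set_type S) : S (set_val x ** set_val y).
Proof. by case: sS => _ SM _; apply: SM; exact: set_valP. Qed.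

Lemma sub_inv_subproof (x : set_type S) : S (inv (set_val x)).
Proof. by case: sS => _ _ SV; apply: SV; exact: set_valP. Qed.

Lemma sub_one_subproof : S e.
Proof. by case: sS. Qed.

(** Ended by [Defined], like the two constructions below, so that the carrier and the operations
    still reduce in later proofs. *)
Definition subTopGroup : topGroup.
Proof.
refine (@TopGroup (set_type S) (fun x y => sub_elt (sub_mul_subproof x y))
  (sub_elt sub_one_subproof) (fun x => sub_elt (sub_inv_subproof x))
  _ _ _ _ _ _).
- by move=> x y z; apply: val_inj; exact: tg_mulA.
- by move=> x; apply: val_inj; exact: tg_mul1g.
- by move=> x; apply: val_inj; exact: tg_mulVg.
- apply: set_type_continuous; apply: continuous_mul.
    exact: comp_continuous (@fst_continuous _ _) (@set_val_continuous _ S).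
  exact: comp_continuous (@snd_continuous _ _) (@set_val_continuous _ S).
- by apply: set_type_continuous; apply: continuous_inv; exact: set_val_continuous.
- exact/set_type_hausdorff/tg_hausdorff.
Defined.

End SubTopGroup.

Lemma closure_subgroup (G : topGroup) (S : set G) :
  is_subgroup S -> is_subgroup (closure S).
Proof.
move=> [S1 SM SV]; split; first exact: subset_closure.
- by move=> x y; apply: closure_mul.
- by move=> x; apply: closure_image => //; exact: tg_inv_cont.
Qed.

Section PtwsTopGroup.
Variables (X : topologicalType) (K : topGroup).

Definition ptwsTopGroup : topGroup.
Proof.
refine (@TopGroup {ptws X -> K} (fun f g x => f x ** g x) (fun _ => e)
  (fun f x => inv (f x)) _ _ _ _ _ _).
- by move=> f g h; apply/funext => x; exact: tg_mulA.
- by move=> f; apply/funext => x; exact: tg_mul1g.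
- by move=> f; apply/funext => x; exact: tg_mulVg.
- apply: prod_topology_continuous => x.
  have cx : continuous (fun f : {ptws X -> K} => f x) by exact: proj_continuous.
  apply: continuous_mul.
    exact: comp_continuous (@fst_continuous _ _) cx.
  exact: comp_continuous (@snd_continuous _ _) cx.
- apply: prod_topology_continuous => x; apply: continuous_inv.
  exact: proj_continuous.
- by apply: (@hausdorff_product X (fun _ => K)) => x; exact: tg_hausdorff.
Defined.

Lemma ptwsTopGroup_compact : compact [set: K] -> compact [set: ptwsTopGroup].
Proof.
move=> cK; have := @tychonoff X (fun _ => K) (fun _ => setT) (fun _ => cK).
by congr compact; apply/seteqP.
Qed.

End PtwsTopGroup.

Section QuotientTopGroup.
Variables (G : topGroup) (N : set G) (sN : is_subgroup N).
Hypotheses (nN : forall k n, N n -> N (k ** n ** inv k)) (cN : closed N).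

(** Left cosets of [N]; the relation is boolean because [EquivRel] asks for one. *)
Definition coset_rel (x y : G) : bool := `[< N (inv x ** y) >].

Lemma coset_rel_refl : reflexive coset_rel.
Proof. by move=> x; apply/asboolP; rewrite tg_mulVg; case: sN. Qed.

Lemma coset_rel_impl x y : coset_rel x y -> coset_rel y x.
Proof.
case: sN => _ _ NV /asboolP /NV; rewrite tg_invMg tg_invgK => xy.
exact/asboolP.
Qed.

Lemma coset_rel_sym : symmetric coset_rel.
Proof. by move=> x y; apply/idP/idP; exact: coset_rel_impl. Qed.

Lemma coset_rel_trans : transitive coset_rel.
Proof.
case: sN => _ NM _ y x z /asboolP xy /asboolP yz; apply/asboolP.
by have := NM _ _ xy yz; rewrite -tg_mulA tg_mulKVg.
Qed.

Canonical coset_equiv := EquivRel coset_rel coset_rel_refl coset_rel_sym coset_rel_trans.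

Definition coset_space := quotient_topology {eq_quot coset_equiv}%qT.

Definition coset_pi (x : G) : coset_space := \pi_coset_space%qT x.

Lemma coset_piP x y : coset_pi x = coset_pi y <-> N (inv x ** y).
Proof.
split=> [/eqmodP/asboolP//|xy].
by apply/eqmodP/asboolP.
Qed.

Lemma coset_repr x : N (inv (repr (coset_pi x)) ** x).
Proof. by apply/coset_piP; rewrite /coset_pi reprK. Qed.

Lemma coset_pi_continuous : continuous coset_pi.
Proof. exact: pi_continuous. Qed.

(** The projection is open: if [y] lies in the coset of some [b] in an open [B], right translation
    by an element of [N] brings [y] back to [b], so points near [y] are congruent to points of
    [B]. *)
Lemma coset_pi_nbhs x (A : set G) :
  nbhs x A -> nbhs (coset_pi x) (coset_pi @` A).
Proof.
rewrite nbhsE => -[B [oB Bx] BA]; rewrite nbhsE; exists (coset_pi @` B).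
  split; last by exists x.
  rewrite /open /= /quotient_open openE => y [b Bb by_].
  have {}by_ : N (inv b ** y) by apply/coset_piP.
  have yB : nbhs y [set z | B (z ** inv (inv b ** y))].
    apply: tg_mulr_cont; rewrite tg_invMg tg_invgK tg_mulKVg.
    exact: open_nbhs_nbhs.
  suff : nbhs y [set z | (coset_pi @` B) (coset_pi z)] by [].
  apply: filterS yB => z Bz; exists (z ** inv (inv b ** y)) => //.
  apply/coset_piP; rewrite tg_invMg tg_invgK.
  by rewrite -tg_mulA tg_mulVg tg_mulg1.
by move=> _ [b Bb <-]; exists b => //; exact: BA.
Qed.

Definition coset_mul (a b : coset_space) := coset_pi (repr a ** repr b).
Definition coset_inv (a : coset_space) := coset_pi (inv (repr a)).

(** With representatives [a] and [b], the identity (a b)^-1 x y = (b^-1 (a^-1 x) b) (b^-1 y) shows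
    where normality enters. *)
Lemma coset_piM x y : coset_mul (coset_pi x) (coset_pi y) = coset_pi (x ** y).
Proof.
apply/coset_piP; set a := repr _; set b := repr _.
have Na : N (inv a ** x) by exact: coset_repr.
have Nb : N (inv b ** y) by exact: coset_repr.
case: sN => _ NM _; have := NM _ _ (nN (inv b) Na) Nb.
by rewrite tg_invgK tg_invMg -!tg_mulA tg_mulKVg.
Qed.

Lemma coset_piV x : coset_inv (coset_pi x) = coset_pi (inv x).
Proof.
apply/coset_piP; set a := repr _; rewrite tg_invgK.
have Na : N (inv a ** x) by exact: coset_repr.
case: sN => _ _ NV; have := NV _ (nN a Na).
by rewrite tg_mulKVg tg_invMg tg_invgK.
Qed.

Lemma coset_pi_surj a : exists x, a = coset_pi x.
Proof. by exists (repr a); rewrite /coset_pi reprK. Qed.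

Definition quotTopGroup : topGroup.
Proof.
refine (@TopGroup coset_space coset_mul (coset_pi e) coset_inv _ _ _ _ _ _).
- move=> a b c; have [x ->] := coset_pi_surj a; have [y ->] := coset_pi_surj b.
  by have [z ->] := coset_pi_surj c; rewrite !coset_piM tg_mulA.
- by move=> a; have [x ->] := coset_pi_surj a; rewrite coset_piM tg_mul1g.
- by move=> a; have [x ->] := coset_pi_surj a; rewrite coset_piV coset_piM tg_mulVg.
- move=> [a b]; have [x ->] := coset_pi_surj a; have [y ->] := coset_pi_surj b.
  move=> W xyW; have : nbhs (coset_pi (x ** y)) W by rewrite -coset_piM.
  move=> /coset_pi_continuous /(@tg_mul_cont G (x, y)).
  move=> [[A B] /= [xA yB] AB].
  (* Openness of the projection turns neighbourhoods in [G] into neighbourhoods of the two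
     cosets. *)
  exists (coset_pi @` A, coset_pi @` B); first by split; exact: coset_pi_nbhs.
  move=> [_ _] /= [[u Au <-] [v Bv <-]].
  by rewrite /= coset_piM; exact: (AB (u, v)).
- apply/quotient_continuous; rewrite -/coset_pi.
  have -> : coset_inv \o coset_pi = coset_pi \o inv.
    by apply/funext => x /=; rewrite coset_piV.
  by move=> x; apply: continuous_comp; [exact: tg_inv_cont|exact: coset_pi_continuous].
- move=> a b; have [x ->] := coset_pi_surj a; have [y ->] := coset_pi_surj b.
  (* Hausdorff: if the neighbourhoods of two cosets always meet, then x^-1 y is in the closure of
     [N], which is [N]. *)
  move=> xy; apply/coset_piP; apply: cN => W.
  have cd : (fun p : G * G => inv p.1 ** p.2) @ (x, y) --> inv x ** y.
    by apply: tg_cvgM; [apply: tg_cvgV; exact: cvg_fst|exact: cvg_snd].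
  move/cd => [[A B] /= [xA yB] AB].
  have [_ [[u Au <-] [v Bv /esym /coset_piP uv]]] :=
    xy _ _ (coset_pi_nbhs xA) (coset_pi_nbhs yB).
  by exists (inv u ** v); split=> //; exact: (AB (u, v)).
Defined.

Lemma quotTopGroup_compact : compact [set: G] -> compact [set: quotTopGroup].
Proof.
move=> cG; have -> : [set: quotTopGroup] = coset_pi @` setT.
  by apply/seteqP; split=> // a _; have [x ->] := coset_pi_surj a; exists x.
by apply: continuous_compact => //; apply: continuous_subspaceT; exact: coset_pi_continuous.
Qed.

End QuotientTopGroup.

(** * Continuous images of precompact groups *)

(* [Gam] is the graph of a homomorphism from a dense subgroup of [M] to [H] that
   is continuous at [1] (which makes it single-valued, see [gam_ker_val]). *)
Section PrecompactImage.
Variables (M H : topGroup) (Gam : M -> H -> Prop).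
Hypotheses (Gam1 : Gam e e)
  (GamM : forall m n h k, Gam m h -> Gam n k -> Gam (m ** n) (h ** k))
  (GamV : forall m h, Gam m h -> Gam (inv m) (inv h))
  (Gam_dense : forall m, closure [set n | exists h, Gam n h] m)
  (Gam_cont : forall U, nbhs e U ->
     exists2 W, nbhs e W & forall m h, W m -> Gam m h -> U h)
  (M_compact : compact [set: M]).

Definition gam_clos (U : set H) := closure [set m | exists2 h, U h & Gam m h].

(** The subgroup [N] of the overview. It is the kernel of the extension of the homomorphism to [M]
    with values in a completion of [H], described without forming that completion. *)
Definition gam_ker : set M := [set m | forall U, nbhs e U -> gam_clos U m].

Lemma gam_closS U V : U `<=` V -> gam_clos U `<=` gam_clos V.
Proof. by move=> UV; apply: closureS => m [h Uh mh]; exists h => //; exact: UV. Qed.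

Lemma gam_closM (U V W : set H) m n : (forall x y, U x -> V y -> W (x ** y)) ->
  gam_clos U m -> gam_clos V n -> gam_clos W (m ** n).
Proof.
move=> UVW; apply: closure_mul => a b [h Uh ah] [k Vk bk].
by exists (h ** k); [exact: UVW|exact: GamM].
Qed.

(** Continuity at the unit gives an open [W'] on which all values lie in [U]; the domain is dense,
    so it meets every open part of [W'], and [W'] lies in the closure. *)
Lemma gam_clos_nbhs U : nbhs e U -> nbhs e (gam_clos U).
Proof.
move=> /Gam_cont[W]; rewrite nbhsE => -[W' [oW' W'1] W'W] WU.
exists W' => // m W'm B mB.
have mWB : nbhs m (W' `&` B) by apply: filterI => //; exact: open_nbhs_nbhs.
have [n [[h nh] [W'n Bn]]] := Gam_dense mWB.
by exists n; split=> //; exists h => //; apply: WU nh; exact: W'W.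
Qed.

Lemma gam_ker_closed : closed gam_ker.
Proof.
move=> m mN U U1; apply: closed_closure.
by apply: closureS mN => n; exact.
Qed.

Lemma gam_ker_subgroup : is_subgroup gam_ker.
Proof.
split=> [U U1|x y Nx Ny U /nbhs1_mul[V V1 VU]|x Nx U /nbhs1_inv/Nx].
- by apply: subset_closure; exists e => //; exact: nbhs_singleton.
- by apply: (gam_closM VU); [exact: Nx|exact: Ny].
- apply: closure_image; first exact: tg_inv_cont.
  by move=> m [h Uh mh]; exists (inv h) => //; exact: GamV.
Qed.

Lemma gam_ker_normal k n : gam_ker n -> gam_ker (k ** n ** inv k).
Proof.
(* The [k] with [k n k^-1] in the kernel form a closed set, which contains the
   dense domain of [Gam]. *)
move=> Nn; have cf : continuous (fun k : M => k ** n ** inv k).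
  apply: continuous_mul; last exact: tg_inv_cont.
  exact: tg_mulr_cont.
apply: gam_ker_closed.
apply: (closure_image (cf k) _ (@Gam_dense k)) => p [q pq] U U1.
pose V := [set v | U (q ** v ** inv q)].
have V1 : nbhs e V.
  have cq : continuous (fun v : H => q ** v ** inv q).
    apply: continuous_mul; first exact: tg_mull_cont.
    by move=> ?; exact: cvg_cst.
  by apply: cq; rewrite tg_mulg1 tg_mulgV.
have cp : continuous (fun n : M => p ** n ** inv p).
  apply: continuous_mul; first exact: tg_mull_cont.
  by move=> ?; exact: cvg_cst.
apply: (closure_image (cp n) _ (Nn V V1)) => m [h Vh mh].
by exists (q ** h ** inv q) => //; do !apply: GamM => //; exact: GamV.
Qed.

(** Passing to the closure enlarges the values only slightly: some [n] close to [m] has a value [k]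
    in [U], and h = k (k^-1 h), where k^-1 h is the value at n^-1 m, which is near the unit. *)
Lemma gam_clos_val (U V : set H) m h : nbhs e U -> (forall x y, U x -> U y -> V (x ** y)) ->
  gam_clos U m -> Gam m h -> V h.
Proof.
move=> U1 UV Um mh; have [W W1 WU] := Gam_cont U1.
have : nbhs m [set n | W (inv n ** m)].
  have cn : continuous (fun n : M => inv n ** m).
    apply: continuous_mul; first exact: tg_inv_cont.
    by move=> ?; exact: cvg_cst.
  by apply: cn; rewrite tg_mulVg.
move=> /Um[n [[k Uk nk] Wn]]; rewrite -(tg_mulKVg k h); apply: UV => //.
by apply: (WU _ _ Wn); apply: GamM => //; exact: GamV.
Qed.

Lemma gam_ker_val m h : gam_ker m -> Gam m h -> h = e.
Proof.
move=> Nm mh; apply: tg_eq1 => U /nbhs1_mul[V V1 VU].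
by apply: (gam_clos_val V1 VU) mh; exact: Nm.
Qed.

Lemma gam_ker1 m : Gam m e -> gam_ker m.
Proof.
by move=> m1 U U1; apply: subset_closure; exists e => //; exact: nbhs_singleton.
Qed.

(** Compactness of [M]: otherwise the sets [gam_clos U] minus [O] generate a proper filter, and a
    cluster point of it lies in every [gam_clos U], hence in [gam_ker], yet outside the open set
    [O]. *)
Lemma gam_clos_small (O : set M) : open O -> gam_ker `<=` O ->
  exists2 U, nbhs e U & gam_clos U `<=` O.
Proof.
move=> oO NO; apply: contrapT => noU.
pose F := [set A : set M | exists2 U, nbhs e U & gam_clos U `\` O `<=` A].
have FF : ProperFilter F.
  split.
    move=> [U U1 U0]; apply: noU; exists U => // m Um.
    by apply: contrapT => nOm; exact: (U0 m).
  split.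
  - by exists setT => //; exact: filterT.
  - move=> A B [U U1 UA] [V V1 VB]; exists (U `&` V); first exact: filterI.
    move=> m [mUV nOm]; split; [apply: UA|apply: VB]; split=> //.
      by apply: gam_closS mUV => ? [].
    by apply: gam_closS mUV => ? [].
  - by move=> A B AB [U U1 UA]; exists U => //; exact: subset_trans AB.
have [m [_ mF]] := M_compact FF (filterT).
apply: (_ : ~ O m) (NO m _).
  have : closure (~` O) m.
    move=> B mB; have [|x [Ax Bx]] := mF (~` O) B _ mB; last by exists x.
    by exists setT; [exact: filterT|move=> ? []].
  by move=> mO Om; have [x [nOx Ox]] := mO _ (open_nbhs_nbhs (conj oO Om)).
move=> U U1; apply: closed_closure => B mB.
have [|x [Ax Bx]] := mF (gam_clos U) B _ mB; last by exists x.
by exists U => // ? [].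
Qed.

Lemma gam_range_precompact : precompact_subgroup [set h | exists m, Gam m h].
Proof.
pose Q := quotTopGroup gam_ker_subgroup gam_ker_normal gam_ker_closed.
pose pi := @coset_pi M gam_ker gam_ker_subgroup : M -> Q.
(* The default [e] is met only outside the range of [Gam]. On the range the choice of preimage is
   harmless: two preimages of [h] differ by an element related to [e], which lies in [gam_ker]. *)
pose phi (h : H) : Q := pi (xget e [set m | Gam m h]).
have phiE m h : Gam m h -> phi h = pi m.
  move=> mh; apply/coset_piP; have := xgetI e (mh : [set m | Gam m h] m).
  move: (xget _ _) => n /= nh.
  by apply: gam_ker1; rewrite -(tg_mulVg h); apply: GamM => //; exact: GamV.
exists Q, phi; split.
- exact: quotTopGroup_compact.
- move=> x y [m mx] [n ny]; rewrite (phiE _ _ mx) (phiE _ _ ny) (phiE _ _ (GamM mx ny)).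
  exact: (esym (coset_piM _ gam_ker_normal m n)).
- move=> x y [m mx] [n ny]; rewrite (phiE _ _ mx) (phiE _ _ ny) => /coset_piP Nmn.
  by apply: tg_eqVM; apply: (gam_ker_val Nmn); apply: GamM => //; exact: GamV.
- apply/subspace_continuousP => h [m mh] B Bh; have {Bh} : nbhs (pi m) B by rewrite -(phiE _ _ mh).
  (* Since [B] is a neighbourhood of the coset of [m], the open set [O] contains the whole kernel,
     so [gam_clos_small] applies to it. *)
  move=> mB; pose O := [set z | B (pi (m ** z))]°.
  have NO : gam_ker `<=` O.
    have cm : continuous (fun z => pi (m ** z)).
      exact: comp_continuous (@tg_mull_cont M m) (@coset_pi_continuous _ _ _).
    move=> n Nn; have /cm : nbhs (pi (m ** n)) B; last by [].
    suff -> : pi (m ** n) = pi m by [].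
    by apply/esym/coset_piP; rewrite tg_mulKg.
  have [U U1 UO] := gam_clos_small (@open_interior _ _) NO.
  apply: filterS (nbhs_mulVl h U1) => k Uk [n nk].
  suff: B (phi k) by []; rewrite (phiE _ _ nk).
  rewrite -(tg_mulKVg m n).
  apply: (@interior_subset _ [set z | B (pi (m ** z))]); apply: UO.
  apply: subset_closure; exists (inv h ** k) => //.
  by apply: GamM => //; exact: GamV.
(* The open set consists of the interior points among the cosets all of whose values lie in [U]. *)
- move=> U oU; exists [set q | forall m h, q = pi m -> Gam m h -> U h]°.
  split; first exact: open_interior.
  apply/seteqP; split=> [_ [h [Uh [m mh]] <-]|q [/interior_subset qU [h [m mh] hq]]];
    last first.
    by exists h => //; split; [apply: (qU m) => //; rewrite -hq; exact: phiE|exists m].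
  split; last by exists h => //; exists m.
  have /nbhs_mull1/nbhs1_mul[V V1 VU] : nbhs h U by exact: open_nbhs_nbhs.
  have [V' V'1 V'V] := nbhs1_mul V1.
  (* If [a] is in this neighbourhood and [n] in the coset of [a], then m^-1 n = (m^-1 a) (a^-1 n) is
     in [gam_clos V], so its value h^-1 k is a product of two elements of [V], up to the closure
     controlled by [gam_clos_val]. *)
  have mA := nbhs_mulVl m (gam_clos_nbhs V'1).
  rewrite (phiE _ _ mh); apply: filterS (coset_pi_nbhs gam_ker_subgroup mA).
  move=> _ [a Aa <-] n k /coset_piP Nan nk.
  rewrite -(tg_mulKVg h k); apply: (gam_clos_val V1 VU (m := inv m ** n)).
    rewrite -(tg_mulKVg a n) tg_mulA; apply: (gam_closM V'V) => //.
    exact: Nan.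
  by apply: GamM => //; exact: GamV.
Qed.

End PrecompactImage.

(** * Homomorphisms from C_p(X, G) to H *)

Definition Cp_mk (X K : topologicalType) (f : X -> K) (cf : continuous f) : Cp X K :=
  SigSub (mem_set (cf : Cpset X K f)).

Lemma Cp_continuousP (X K : topologicalType) (f : Cp X K) :
  continuous (set_val f : X -> K).
Proof. exact: set_valP f. Qed.

Lemma Cp_eq (X K : topologicalType) (f g : Cp X K) :
  (forall x, set_val f x = set_val g x) -> f = g.
Proof. by move=> fg; apply: val_inj; apply/funext. Qed.

Lemma Cp_cvg (X K : topologicalType) (F : set_system (Cp X K)) {FF : Filter F}
    (f : Cp X K) :
  (forall x, (fun g : Cp X K => set_val g x) @ F --> set_val f x) -> F --> f.
Proof.
move=> Ff; apply/(@set_type_cvg _ _ _ F FF id f).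
by apply/(@prod_topology_cvg _ _ (set_val @ F)) => x; exact: Ff.
Qed.

Lemma Cp_continuous (S X K : topologicalType) (f : S -> Cp X K) :
  (forall x, continuous (fun s => set_val (f s) x)) -> continuous f.
Proof.
by move=> cf; apply: set_type_continuous; apply: prod_topology_continuous.
Qed.

Lemma Cp_eval_continuous (X K : topologicalType) (x : X) :
  continuous (fun f : Cp X K => set_val f x).
Proof.
have cx : continuous (fun f : {ptws X -> K} => f x) by exact: (@proj_continuous X).
exact: comp_continuous (@set_val_continuous _ _) cx.
Qed.

Section CpHom.
Variables (X : topologicalType) (G H : topGroup) (theta : Cp X G -> H).
Hypotheses (thetaM : forall f g h : Cp X G,
    (forall x, set_val h x = set_val f x ** set_val g x) ->
    theta h = theta f ** theta g)
  (theta_cont : continuous theta).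

Definition Cp_one : Cp X G := Cp_mk (@cst_continuous X G e).

Definition Cp_mul (f g : Cp X G) : Cp X G :=
  Cp_mk (continuous_mul (@Cp_continuousP _ _ f) (@Cp_continuousP _ _ g)).

Definition Cp_inv (f : Cp X G) : Cp X G :=
  Cp_mk (continuous_inv (@Cp_continuousP _ _ f)).

Lemma theta_mul f g : theta (Cp_mul f g) = theta f ** theta g.
Proof. exact: thetaM. Qed.

Lemma theta_one : theta Cp_one = e.
Proof. by apply: tg_idem; apply: thetaM => x; rewrite /= tg_mul1g. Qed.

Lemma theta_inv f : theta (Cp_inv f) = inv (theta f).
Proof.
apply/esym/tg_eqVM; rewrite tg_invgK -theta_mul -theta_one.
by congr theta; apply: Cp_eq => x; exact: tg_mulgV.
Qed.

(** * Case (ii): C_p(X, G) inside a compact power *)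

Section Precompact.
Variables (K : topGroup) (phi : G -> K).
Hypotheses (cK : compact [set: K])
  (phiM : forall x y, phi (x ** y) = phi x ** phi y)
  (phi_inj : injective phi)
  (phi_open : forall U : set G, open U ->
    exists W : set K, open W /\ phi @` U = W `&` range phi).

Lemma phi_one : phi e = e.
Proof. by apply: tg_idem; rewrite -phiM tg_mul1g. Qed.

Lemma phi_inv x : phi (inv x) = inv (phi x).
Proof. by apply/esym/tg_eqVM; rewrite tg_invgK -phiM tg_mulgV phi_one. Qed.

(** The target is the full power of [K], compact by Tychonoff's theorem. *)
Definition Cp_push (f : Cp X G) : ptwsTopGroup X K := fun x => phi (set_val f x).

Lemma Cp_push_subgroup : is_subgroup (range Cp_push).
Proof.
split.
- by exists Cp_one => //; apply/funext => x; rewrite /Cp_push /= phi_one.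
- move=> _ _ [f _ <-] [g _ <-]; exists (Cp_mul f g) => //; apply/funext => x.
  by rewrite /Cp_push /= phiM.
- move=> _ [f _ <-]; exists (Cp_inv f) => //; apply/funext => x.
  by rewrite /Cp_push /= phi_inv.
Qed.

(** The sets [A] admitting such a [B] form a filter, and its convergence to [f] can be tested at one
    point of [X] at a time, where [phi_open] provides [B]. This transports continuity of [theta] to
    the image of [Cp_push]. *)
Lemma Cp_push_embedding (f : Cp X G) (A : set (Cp X G)) : nbhs f A ->
  exists2 B, nbhs (Cp_push f) B & forall g, B (Cp_push g) -> A g.
Proof.
pose F : set_system (Cp X G) := [set A : set (Cp X G) |
  exists2 B, nbhs (Cp_push f) B & forall g, B (Cp_push g) -> A g].
have FF : Filter F.
  split.
  - by exists setT => //; exact: filterT.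
  - move=> A1 A2 [B1 fB1 BA1] [B2 fB2 BA2].
    exists (B1 `&` B2); first exact: filterI.
    by move=> g [/BA1 ? /BA2].
  - by move=> A1 A2 A12 [B fB BA]; exists B => // g /BA /A12.
suff Ff : F --> f by exact: Ff.
apply: Cp_cvg => x V; rewrite nbhsE => -[V' [oV' V'f] V'V].
have [W [oW VW]] := phi_open oV'.
have WP g : W (phi (set_val g x)) -> V' (set_val g x).
  move=> Wg; have : (W `&` range phi) (phi (set_val g x)) by split=> //; exists (set_val g x).
  by rewrite -VW => -[v V'v /phi_inj <-].
exists [set p | W (p x)]; last by move=> g /WP /V'V.
apply: (@proj_continuous X (fun _ => K) x).
apply: open_nbhs_nbhs; split=> //.
have : (phi @` V') (phi (set_val f x)) by exists (set_val f x).
by rewrite VW => -[].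
Qed.

Definition push_group := subTopGroup (closure_subgroup Cp_push_subgroup).

Lemma push_group_compact : compact [set: push_group].
Proof.
apply: compact_set_type.
apply: subclosed_compact (ptwsTopGroup_compact cK) _ => //.
exact: closed_closure.
Qed.

Definition push_elt (f : Cp X G) : push_group :=
  sub_elt (@subset_closure (ptwsTopGroup X K) (range Cp_push) _ (ex_intro2 _ _ f I erefl)).

(** The graph of [theta] seen through [Cp_push]; a relation spares inverting [Cp_push] on its
    image. *)
Definition push_rel (m : push_group) (h : H) :=
  exists f, m = push_elt f /\ h = theta f.

Lemma push_range_precompact : precompact_subgroup [set h | exists m, push_rel m h].
Proof.
apply: gam_range_precompact.
- exists Cp_one; split; last exact/esym/theta_one.
  by apply: val_inj; apply/funext => x; rewrite /= /Cp_push /= phi_one.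
- move=> _ _ _ _ [f [-> ->]] [g [-> ->]]; exists (Cp_mul f g); rewrite theta_mul.
  by split=> //; apply: val_inj; apply/funext => x; rewrite /= /Cp_push /= phiM.
- move=> _ _ [f [-> ->]]; exists (Cp_inv f); rewrite theta_inv.
  by split=> //; apply: val_inj; apply/funext => x; rewrite /= /Cp_push /= phi_inv.
- move=> m B [V [[Z oZ <-] Zm VB]].
  have [_ [[f _ <-] Zf]] := set_valP m Z (open_nbhs_nbhs (conj oZ Zm)).
  by exists (push_elt f); split; [exists (theta f), f|exact: VB].
- move=> U; rewrite -theta_one => /theta_cont /Cp_push_embedding[B B1 BU].
  exists [set m | B (set_val m)].
    have e_push : Cp_push Cp_one = set_val (e : push_group).
      by apply/funext => x; rewrite /Cp_push /= phi_one.
    by apply: set_val_continuous; rewrite -e_push.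
  by move=> m _ Bm [f [mf ->]]; apply: BU; move: Bm; rewrite mf.
- exact: push_group_compact.
Qed.

Lemma push_range_subgroup : is_subgroup [set h | exists m, push_rel m h].
Proof.
split.
- by exists (push_elt Cp_one), Cp_one; rewrite theta_one.
- move=> _ _ [_ [f [_ ->]]] [_ [g [_ ->]]].
  by exists (push_elt (Cp_mul f g)), (Cp_mul f g); rewrite theta_mul.
- move=> _ [_ [f [_ ->]]].
  by exists (push_elt (Cp_inv f)), (Cp_inv f); rewrite theta_inv.
Qed.

End Precompact.

Lemma theta_trivial_precompact f :
  precompact_group G -> no_nontrivial_precompact_subgroups H -> theta f = e.
Proof.
move=> [K [phi [cK phiM phi_inj phi_cont phi_open]]] nH.
have phiM' x y : phi (x ** y) = phi x ** phi y by exact: phiM.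
have phi_inj' : injective phi by move=> x y; exact: phi_inj.
have phi_open' U : open U -> exists W : set K, open W /\ phi @` U = W `&` range phi.
  by move=> /phi_open; rewrite setIT.
have := nH _ (push_range_subgroup phiM') (push_range_precompact cK phiM' phi_inj' phi_open').
move=> /seteqP[+ _]; move=> /(_ (theta f)) /=; apply.
by exists (push_elt phiM' f), f.
Qed.

End CpHom.

(** * Case (i): paths and interpolation *)

Lemma path_extension (T : topologicalType) (x y : T) :
  pathwise_connected T ->
  exists q : Rr -> T, [/\ continuous q, q 0 = x & q 1 = y].
Proof.
move=> /(_ x y)[p [cp p0 p1]].
(* Clamping to [0, 1] makes the path total, so that it can be composed with unbounded real
   functions. *)
pose c (t : Rr) : Rr := Num.max 0 (Num.min 1 t).
have cc : continuous c.
  have cst_c (a : Rr) : continuous (fun _ : Rr => a) by move=> ?; exact: cvg_cst.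
  have id_c : continuous (fun t : Rr => t) by move=> ?; exact: cvg_id.
  by move=> t; have := continuous_max (cst_c 0 t) (continuous_min (cst_c 1 t) (id_c t)).
have c01 t : `[0%R, 1%R]%classic (c t).
  by rewrite /= in_itv /= /c le_max lexx /= ge_max ler01 ge_min lexx.
exists (fun t => p (c t)); split.
- move=> t B pB; move/subspace_continuousP: cp => /(_ _ (c01 t) B pB) cB.
  by apply: (@filterS _ (nbhs t) _ _ _ _ (cc t _ cB)) => s; apply; exact: c01.
- by rewrite /c min_r ?ler01// max_l.
- by rewrite /c min_l// max_r ?ler01.
Qed.

Lemma hereditarily_disconnected_path (T : topologicalType) (q : Rr -> T) s t :
  hereditarily_disconnected T -> continuous q -> q s = q t.
Proof.
move=> dT cq; apply: (dT (q @` setT)); last 2 first.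
- by exists s.
- by exists t.
apply: connected_continuous_connected; last exact: continuous_subspaceT.
by apply/connected_intervalP.
Qed.

Section Path.
Variables (X : topologicalType) (G H : topGroup) (theta : Cp X G -> H).
Hypotheses (thetaM : forall f g h : Cp X G,
    (forall x, set_val h x = set_val f x ** set_val g x) ->
    theta h = theta f ** theta g)
  (theta_cont : continuous theta)
  (tX : tychonoff_space X) (pG : pathwise_connected G)
  (dH : hereditarily_disconnected H).

Lemma theta_path (q : Rr -> G) (u : X -> Rr) (cq : continuous q) (cu : continuous u) :
  q 0 = e -> theta (Cp_mk (comp_continuous cu cq)) = e.
Proof.
move=> q0.
have cu_ t : continuous (fun x => t * u x).
  exact: comp_continuous cu (@mulrl_continuous _ t).
(* A path in C_p(X, G) from the unit at 0 to the given map at 1; its continuity is tested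
   pointwise. *)
pose h t : Cp X G := Cp_mk (comp_continuous (cu_ t) cq).
have ch : continuous h.
  apply: Cp_continuous => x /=.
  exact: comp_continuous (@mulrr_continuous _ (u x)) cq.
have := hereditarily_disconnected_path 1 0 dH (comp_continuous ch theta_cont).
have -> : h 1 = Cp_mk (comp_continuous cu cq).
  by apply: Cp_eq => x; exact: (congr1 q (mul1r (u x))).
move->; rewrite -(theta_one thetaM); congr theta.
by apply: Cp_eq => x; exact: (etrans (congr1 q (mul0r (u x))) q0).
Qed.

(** Induction on [s]: the map [k] obtained so far is corrected at a new point [x] by a left factor
    that is [e] on [s] and f(x) k(x)^-1 at [x]. *)
Lemma theta_interpolation (s : seq X) (f : Cp X G) :
  exists2 k, theta k = e & forall x, x \in s -> set_val k x = set_val f x.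
Proof.
have [_ aX sX] := tX.
elim: s => [|x s [k k1 kf]]; first by exists (Cp_one X G); [exact: theta_one|].
have [xs|xs] := boolP (x \in s).
  by exists k => // y; rewrite inE => /orP[/eqP ->|]; exact: kf.
have [q [cq q0 q1]] := path_extension e (set_val f x ** inv (set_val k x)) pG.
have cs : closed [set y | y \in s].
  by move/accessible_finite_set_closed: aX; apply; exact: finite_seq.
have [u [cu ux us]] := sX x _ cs (negP xs).
(* The separating function [u] is 0 at [x] and 1 on [s]; the path starts at [e], so it is followed
   along 1 - u. *)
have cv : continuous (fun y => 1 - u y).
  by move=> y; apply: (@cvgB Rr Rr^o _ (nbhs y) _ (fun _ => 1) u); [exact: cvg_cst|exact: cu].
exists (Cp_mul (Cp_mk (comp_continuous cv cq)) k).
  by rewrite theta_mul// theta_path// k1 tg_mul1g.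
move=> y; rewrite -[LHS]/(q (1 - u y) ** set_val k y) inE => /orP[/eqP ->|ys].
  by rewrite ux subr0 q1 tg_mulgKV.
by rewrite us// subrr q0 tg_mul1g kf.
Qed.

Lemma theta_trivial_path f : theta f = e.
Proof.
(* Pointwise convergence: the maps agreeing with [f] on a finite set of points
   converge to [f] as this set grows. *)
apply: contrapT => fn1; pose F : set_system (Cp X G) := [set A : set (Cp X G) |
  exists s : seq X, forall g : Cp X G,
    (forall x, x \in s -> set_val g x = set_val f x) -> A g].
have FF : Filter F.
  split.
  - by exists [::].
  - move=> A B [s sA] [t tB]; exists (s ++ t) => g gf; split.
      by apply: sA => x xs; apply: gf; rewrite mem_cat xs.
    by apply: tB => x xt; apply: gf; rewrite mem_cat xt orbT.
  - by move=> A B AB [s sA]; exists s => g /sA /AB.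
have Ff : F --> f.
  apply: Cp_cvg => x V /nbhs_singleton Vf; exists [:: x] => g gf.
  by rewrite /= gf// mem_head.
have ne1 : nbhs (theta f) (~` [set e]).
  apply: open_nbhs_nbhs; split=> //; apply: closed_openC.
  exact/accessible_closed_set1/hausdorff_accessible/tg_hausdorff.
(* By [sF], [theta] avoids [e] on all maps agreeing with [f] on [s]; interpolation yields one in the
   kernel. *)
have [s sF] := Ff _ (theta_cont ne1).
by have [k k1 /sF] := theta_interpolation s f.
Qed.

End Path.

Lemma Cp_hom_trivial (G H : topGroup) :
  (pathwise_connected G /\ hereditarily_disconnected H) \/
  (precompact_group G /\ no_nontrivial_precompact_subgroups H) ->
  forall X : topologicalType, tychonoff_space X ->
  forall theta : Cp X G -> H,
  (forall f g h : Cp X G, (forall x, set_val h x = set_val f x ** set_val g x) ->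
    theta h = theta f ** theta g) ->
  continuous theta -> forall f, theta f = e.
Proof.
move=> [[pG dH]|[pG nH]] X tX theta thetaM ctheta f.
  exact: theta_trivial_path.
exact: theta_trivial_precompact.
Qed.

(** * Splitting an isomorphism *)

Section Factors.
Variables G H : topGroup.
Notation GH := (G * H)%type.

Lemma pair_continuous (X : topologicalType) (f : X -> G) (g : X -> H) :
  continuous f -> continuous g -> continuous (fun x => (f x, g x) : GH).
Proof. by move=> cf cg x; apply: (cvg_pair (F := nbhs x)); [exact: cf|exact: cg]. Qed.

Definition Cp_fst (X : topologicalType) (f : Cp X GH) : Cp X G :=
  Cp_mk (comp_continuous (@Cp_continuousP _ _ f) (@fst_continuous G H)).

Definition Cp_snd (X : topologicalType) (f : Cp X GH) : Cp X H :=
  Cp_mk (comp_continuous (@Cp_continuousP _ _ f) (@snd_continuous G H)).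

Definition Cp_inl (X : topologicalType) (f : Cp X G) : Cp X GH :=
  Cp_mk (pair_continuous (@Cp_continuousP _ _ f) (@cst_continuous X H e)).

Definition Cp_inr (X : topologicalType) (f : Cp X H) : Cp X GH :=
  Cp_mk (pair_continuous (@cst_continuous X G e) (@Cp_continuousP _ _ f)).

Variables X : topologicalType.

Lemma Cp_fst_continuous : continuous (@Cp_fst X).
Proof.
apply: Cp_continuous => x.
exact: comp_continuous (@Cp_eval_continuous X GH x) (@fst_continuous G H).
Qed.

Lemma Cp_snd_continuous : continuous (@Cp_snd X).
Proof.
apply: Cp_continuous => x.
exact: comp_continuous (@Cp_eval_continuous X GH x) (@snd_continuous G H).
Qed.

Lemma Cp_inl_continuous : continuous (@Cp_inl X).
Proof.
apply: Cp_continuous => x.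
exact: pair_continuous (@Cp_eval_continuous X G x) (@cst_continuous _ H e).
Qed.

Lemma Cp_inr_continuous : continuous (@Cp_inr X).
Proof.
apply: Cp_continuous => x.
exact: pair_continuous (@cst_continuous _ G e) (@Cp_eval_continuous X H x).
Qed.

Lemma Cp_inl_mul (f g h : Cp X G) :
  (forall x, set_val h x = set_val f x ** set_val g x) ->
  forall x, set_val (Cp_inl h) x = prod_mul (set_val (Cp_inl f) x) (set_val (Cp_inl g) x).
Proof. by move=> hfg x; exact: (congr2 pair (hfg x) (esym (tg_mul1g e))). Qed.

Lemma Cp_inr_mul (f g h : Cp X H) :
  (forall x, set_val h x = set_val f x ** set_val g x) ->
  forall x, set_val (Cp_inr h) x = prod_mul (set_val (Cp_inr f) x) (set_val (Cp_inr g) x).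
Proof. by move=> hfg x; exact: (congr2 pair (esym (tg_mul1g e)) (hfg x)). Qed.

Lemma Cp_decomposition (f : Cp X GH) x : set_val f x =
  prod_mul (set_val (Cp_inl (Cp_fst f)) x) (set_val (Cp_inr (Cp_snd f)) x).
Proof.
rewrite [LHS]surjective_pairing.
exact: (congr2 pair (esym (tg_mulg1 _)) (esym (tg_mul1g _))).
Qed.

End Factors.

Definition Cp_morphism (G H : topGroup) (X Y : topologicalType)
    (Phi : Cp X (G * H)%type -> Cp Y (G * H)%type) :=
  forall f g h : Cp X (G * H)%type,
    (forall x, set_val h x = prod_mul (set_val f x) (set_val g x)) ->
    forall y, set_val (Phi h) y = prod_mul (set_val (Phi f) y) (set_val (Phi g) y).

(** The morphism property speaks of a given product [h], so the pointwise product [k] of [Psi f] and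
    [Psi g] is built first; then [h] and [Phi k] are both the product of [f] and [g]. *)
Lemma Cp_morphism_inverse (G H : topGroup) (X Y : topologicalType)
    (Phi : Cp X (G * H)%type -> Cp Y (G * H)%type) Psi :
  cancel Phi Psi -> cancel Psi Phi -> Cp_morphism Phi -> Cp_morphism Psi.
Proof.
move=> PhiK PsiK PhiM f g h hfg x.
have cfst := @fst_continuous G H; have csnd := @snd_continuous G H.
have c1 := continuous_mul (comp_continuous (@Cp_continuousP _ _ (Psi f)) cfst)
  (comp_continuous (@Cp_continuousP _ _ (Psi g)) cfst).
have c2 := continuous_mul (comp_continuous (@Cp_continuousP _ _ (Psi f)) csnd)
  (comp_continuous (@Cp_continuousP _ _ (Psi g)) csnd).
pose k : Cp X (G * H)%type := Cp_mk (pair_continuous c1 c2).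
have -> : h = Phi k.
  apply: Cp_eq => y.
  have := PhiM (Psi f) (Psi g) k (fun x => erefl) y.
  by rewrite !PsiK => ->.
by rewrite PhiK.
Qed.

Section Splitting.
Variables (G H : topGroup) (X Y : topologicalType).
Hypothesis GH : (pathwise_connected G /\ hereditarily_disconnected H) \/
  (precompact_group G /\ no_nontrivial_precompact_subgroups H).

(** For each [y], the second component at [y] is a continuous homomorphism from C_p(X, G) to [H],
    trivial by [Cp_hom_trivial]. *)
Lemma Cp_morphism_inl (tX : tychonoff_space X)
    (Phi : Cp X (G * H)%type -> Cp Y (G * H)%type) f :
  Cp_morphism Phi -> continuous Phi ->
  Phi (Cp_inl H f) = Cp_inl H (Cp_fst (Phi (Cp_inl H f))).
Proof.
move=> PhiM cPhi; apply: Cp_eq => y.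
rewrite [LHS]surjective_pairing; congr pair.
pose theta (f : Cp X G) : H := (set_val (Phi (Cp_inl H f)) y).2.
apply: (Cp_hom_trivial (theta := theta) GH tX).
  by move=> g h k /(Cp_inl_mul H) /PhiM /(_ y) kgh; rewrite /theta kgh.
apply: comp_continuous (@snd_continuous G H).
apply: comp_continuous (@Cp_eval_continuous _ _ y).
exact: comp_continuous (@Cp_inl_continuous G H X) cPhi.
Qed.

End Splitting.

Section Inverse.
Variables (G H : topGroup) (X Y : topologicalType).
Hypothesis GH : (pathwise_connected G /\ hereditarily_disconnected H) \/
  (precompact_group G /\ no_nontrivial_precompact_subgroups H).
Hypotheses (tX : tychonoff_space X) (tY : tychonoff_space Y).
Variables (Phi : Cp X (G * H)%type -> Cp Y (G * H)%type)
  (Psi : Cp Y (G * H)%type -> Cp X (G * H)%type).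
Hypotheses (PhiK : cancel Phi Psi) (PhiM : Cp_morphism Phi) (PsiM : Cp_morphism Psi)
  (cPhi : continuous Phi) (cPsi : continuous Psi).

Lemma Cp_fst_cancel : cancel (fun f => Cp_fst (Phi (Cp_inl H f)))
  (fun f => Cp_fst (Psi (Cp_inl H f))).
Proof.
move=> f; rewrite -(Cp_morphism_inl GH tX f PhiM cPhi) PhiK.
exact: Cp_eq.
Qed.

(** The first component of Phi (1, f) may be nontrivial. It is split off by [Cp_decomposition];
    [Psi] keeps it in the factor C_p(X, G), so it disappears from the second component. *)
Lemma Cp_snd_cancel : cancel (fun f => Cp_snd (Phi (Cp_inr G f)))
  (fun f => Cp_snd (Psi (Cp_inr G f))).
Proof.
move=> f; apply: Cp_eq => x.
have := PsiM (Cp_decomposition (Phi (Cp_inr G f))) x.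
rewrite PhiK (Cp_morphism_inl GH tY _ PsiM cPsi) => /(congr1 snd).
by rewrite /prod_mul /= => fx; rewrite [RHS](etrans fx (tg_mul1g _)).
Qed.

End Inverse.

Theorem theorem3p2 (G H : topGroup) :
  (pathwise_connected G /\ hereditarily_disconnected H) \/
  (precompact_group G /\ no_nontrivial_precompact_subgroups H) ->
  forall X Y : topologicalType, tychonoff_space X -> tychonoff_space Y ->
    GxH_equivalent G H X Y -> K_equivalent G X Y /\ K_equivalent H X Y.
Proof.
move=> GH X Y tX tY [Phi [Psi [PhiK PsiK cPhi cPsi PhiM]]].
have PsiM := Cp_morphism_inverse PhiK PsiK PhiM.
split.
- exists (fun f => Cp_fst (Phi (Cp_inl H f))), (fun f => Cp_fst (Psi (Cp_inl H f))).
  (* The second cancellation is the first with [X] and [Y], and [Phi] and [Psi], exchanged. *)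
  split; [exact: Cp_fst_cancel|exact: Cp_fst_cancel| | |].
  + exact: comp_continuous (comp_continuous (@Cp_inl_continuous G H X) cPhi)
      (@Cp_fst_continuous G H Y).
  + exact: comp_continuous (comp_continuous (@Cp_inl_continuous G H Y) cPsi)
      (@Cp_fst_continuous G H X).
  + by move=> f g h /(Cp_inl_mul H) /PhiM hfg y; exact: (congr1 fst (hfg y)).
- exists (fun f => Cp_snd (Phi (Cp_inr G f))), (fun f => Cp_snd (Psi (Cp_inr G f))).
  split; [exact: Cp_snd_cancel|exact: Cp_snd_cancel| | |].
  + exact: comp_continuous (comp_continuous (@Cp_inr_continuous G H X) cPhi)
      (@Cp_snd_continuous G H Y).
  + exact: comp_continuous (comp_continuous (@Cp_inr_continuous G H Y) cPsi)
      (@Cp_snd_continuous G H X).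
  + by move=> f g h /(Cp_inr_mul G) /PhiM hfg y; exact: (congr1 snd (hfg y)).
Qed.
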